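(* Let $G$ be a finite group. (a) If $H\le G$ is a subgroup, then $\omega(H)\subseteq\omega(G)$; in particular $\eta(H)\le\eta(G)$. (b) If $N\trianglelefteq G$ is a normal subgroup, then $\omega(G/N)\subseteq\omega(G)$; in particular $\eta(G/N)\le\eta(G)$.
   Context: For a finite group $G$, $\omega(G)$ denotes the set of orders of elements of $G$ and $\eta(G)=|\omega(G)|$. *)

(* Defs.v *)
From mathcomp Require Import all_boot all_fingroup finmap.

Set Implicit Arguments.
Unset Strict Implicit.
Unset Printing Implicit Defensive.

Local Open Scope fset_scope.

(* [omega] and [eta] take a bare set of elements, so that they apply to a
   {group gT} through its coercion and to a quotient [G / N] directly. *)
Definition omega (gT : finGroupType) (A : {set gT}) : {fset nat} :=
  [fset #[x]%g | x in A].

Definition eta (gT : finGroupType) (A : {set gT}) : nat := #|` omega A|.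

(* Main.v *)
Require Import Defs.
From mathcomp Require Import all_boot all_fingroup finmap.
From mathcomp Require Import cyclic.

(** The order of an element is the same in a subgroup as in the ambient group,
    which settles subgroups. For quotients, the order of a coset [xN] need not
    be the order of any of its representatives, but it divides the order of
    [x]; and the orders realised in a group are closed under divisors, since a
    power of [x] has any prescribed order dividing that of [x] ([omega_dvd]).
    Hence the order of [xN] is attained in [G] by a power of [x]
    ([omega_quotient]). *)

Lemma omegaP (gT : finGroupType) (A : {set gT}) (n : nat) :
  reflect (exists2 x, x \in A & n = #[x]%g) (n \in omega A).
Proof. exact: imfsetP. Qed.

Lemma omegaS (gT : finGroupType) (A B : {set gT}) :
  A \subset B -> (omega A `<=` omega B)%fset.
Proof.
move=> /subsetP sAB; apply/fsubsetP=> _ /omegaP[x Ax ->].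
by apply/omegaP; exists x; first exact: sAB.
Qed.

(** If [m] divides [#[x]], then [x ^+ (#[x] %/ m)] has order [m]. *)
Lemma omega_dvd (gT : finGroupType) (G : {group gT}) (m n : nat) :
  m %| n -> n \in omega G -> m \in omega G.
Proof.
move=> dvd_mn /omegaP[x Gx def_n]; rewrite {}def_n in dvd_mn.
apply/omegaP; exists (x ^+ (#[x] %/ m))%g; first exact: groupX.
by rewrite orderXdiv ?dvdn_div // divnA // mulKn ?order_gt0.
Qed.

(** The order of a coset divides that of a representative, [coset N] being a
    morphism on the normaliser of [N]; [omega_dvd] then applies. *)
Lemma omega_quotient (gT : finGroupType) (G N : {group gT}) :
  (omega (G / N)%g `<=` omega G)%fset.
Proof.
apply/fsubsetP=> _ /omegaP[_ /morphimP[x Nx Gx ->] ->].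
apply: (omega_dvd _ _ _ #[x]%g); first exact: morph_order.
by apply/omegaP; exists x.
Qed.

Theorem proposition3p1 (gT : finGroupType) (G : {group gT}) :
  (forall H : {group gT}, H \subset G ->
     (omega H `<=` omega G)%fset /\ eta H <= eta G) /\
  (forall N : {group gT}, (N <| G)%g ->
     (omega (G / N)%g `<=` omega G)%fset /\ eta (G / N)%g <= eta G).
Proof.
split=> [H sHG | N _].
  by split; [|apply: fsubset_leq_card]; apply: omegaS.
by split; [|apply: fsubset_leq_card]; apply: omega_quotient.
Qed.
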